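(* (Young's inequality for an exponential density.) Let $1<p<2$, let $p'$ be defined by $\frac1p+\frac1{p'}=1$, and let $\varphi(x)=e^{-|x|}$ on $\mathbb R$. Set \[ A_p=\left(\frac{p'}{2}\right)^{2/p}\left[\frac{\Gamma\!\left(\frac{2p}{2-p}\right)}{\Gamma\!\left(\frac{2}{2-p}\right)\Gamma\!\left(\frac{p}{2-p}\right)}\right]^{\frac{2}{p}-1}. \] Then for every $f\in L^p(\mathbb R)$, \[ \|\varphi*f\|_{L^{p'}(\mathbb R)}\le A_p\,\|f\|_{L^p(\mathbb R)} . \]
   Context: Here $\varphi*f(x)=\int_{\mathbb R}\varphi(x-y)f(y)\,dy$ denotes convolution on $\mathbb R$. *)

(* Defs.v *)
From HB Require Import structures.
From mathcomp Require Import all_boot all_order all_algebra.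
From mathcomp Require Import all_classical all_reals all_analysis.
Set Implicit Arguments. Unset Strict Implicit. Unset Printing Implicit Defensive.
Import Order.TTheory GRing.Theory Num.Theory.
Local Open Scope classical_set_scope.
Local Open Scope ring_scope.

Definition Gamma (R : realType) (s : R) : R :=
  fine (\int[@lebesgue_measure R]_(t in `]0%R, +oo[%classic)
          ((t `^ (s - 1)) * expR (- t))%:E)%E.

Definition convol (R : realType) (phi f : R -> R) (x : R) : \bar R :=
  (\int[@lebesgue_measure R]_(y in [set: R]) (phi (x - y) * f y)%:E)%E.

Definition expdens (R : realType) (x : R) : R := expR (- `|x|).

Definition conj_exp (R : realType) (p : R) : R := p / (p - 1).

Definition A_const (R : realType) (p : R) : R :=
  (conj_exp p / 2) `^ (2 / p) *
  (Gamma (2 * p / (2 - p)) / (Gamma (2 / (2 - p)) * Gamma (p / (2 - p))))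
    `^ (2 / p - 1).

(* Main.v *)
Require Import Defs.
From HB Require Import structures.
From mathcomp Require Import all_boot all_order all_algebra.
From mathcomp Require Import ring lra.
From mathcomp Require Import all_classical all_reals all_analysis.
From mathcomp Require Import measurable_realfun.
Import Order.TTheory GRing.Theory Num.Theory.
Import numFieldNormedType.Exports.
Set Implicit Arguments.
Unset Strict Implicit.
Unset Printing Implicit Defensive.
Local Open Scope classical_set_scope.
Local Open Scope ring_scope.

(* The constant [A_const p] is far from optimal, so a crude form of Young's
   inequality suffices. With [q = p'], Hoelder applied to
   [phi f = (phi^(1/2) f) phi^(1/2)] gives
   [|phi * f|^q (x) <= (4/q) (int phi^(p/2)(x - y) |f(y)|^p dy)^(q/p)];
   since [phi <= 1] and [p < q], all but one power of the inner integral is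
   bounded by [int |f|^p], and Tonelli yields
   [||phi * f||_q <= (16/(p q))^(1/q) ||f||_p <= 2^(2/q) ||f||_p].
   With [a = p/(2-p)] the constant is
   [A_p^a = (a/(a-1))^(a+1) Gamma(2a) / (Gamma(a+1) Gamma(a))], where the first
   factor is at least [2] and the Gamma quotient at least [2^(a-2)]: it is at
   least [1] by Chebyshev's association inequality and at least doubles when [a]
   increases by [1]. Hence [A_p >= 2^((a-1)/a) = 2^(2/q)]. *)

(** * Elementary exponential bounds and the half-line exponential integral *)

Lemma powR_le_expR (R : realType) (r t : R) : 0 <= r -> 0 < t ->
  t `^ r <= (2 * r) `^ r * expR (t / 2).
Proof.
rewrite le_eqVlt => /predU1P[<- t0|r0 t0].
  by rewrite !powRr0 mul1r -expR0 ler_expR divr_ge0// ltW.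
have r20 : 0 < 2 * r by rewrite mulr_gt0.
(* With [u = t / (2 * r)], the claim is the [r]-th power of [u <= expR u]. *)
have -> : expR (t / 2) = expR (t / (2 * r)) `^ r.
  by rewrite -expRM; congr expR; field; rewrite gt_eqF.
rewrite -powRM ?expR_ge0 ?(ltW r20)//.
apply: ge0_ler_powR; rewrite ?nnegrE ?(ltW r0) ?(ltW t0)//.
  by rewrite mulr_ge0 ?expR_ge0 ?(ltW r20).
rewrite -[leLHS](divfK (lt0r_neq0 r20)) mulrC ler_pM2l//.
by rewrite (le_trans _ (expR_ge1Dx _))// lerDr.
Qed.

(** From [1 + y <= expR y] at [y = x^-1 - 1]: inverting gives [expR (1 - x^-1) <= x], and then the
    [r]-th power is taken. *)
Lemma expR_le_powR (R : realType) (x r : R) : 0 < x -> 0 <= r ->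
  expR (r * (1 - x^-1)) <= x `^ r.
Proof.
move=> x0 r0; rewrite mulrC expRM.
apply: ge0_ler_powR; rewrite ?nnegrE ?expR_ge0 ?(ltW x0)//.
rewrite -opprB expRN -[leRHS]invrK lef_pV2 ?posrE ?expR_gt0 ?invr_gt0//.
by rewrite (le_trans _ (expR_ge1Dx _))// addrC subrK.
Qed.

Lemma integral_expR_cy (R : realType) (c : R) : 0 < c ->
  (\int[@lebesgue_measure R]_(t in `[0%R, +oo[) (expR (- (c * t)))%:E =
   (c^-1)%:E)%E.
Proof.
move=> c0; pose F (t : R) := - c^-1 * expR (- (c * t)).
have dF (x : R) : is_derive x 1 F (expR (- (c * x))).
  apply: is_derive_eq; rewrite /GRing.scale/=.
  by field; rewrite gt_eqF.
rewrite (@ge0_continuous_FTC2y _ _ F 0 0)//.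
- by rewrite /F mulr0 oppr0 expR0 mulr1 sub0e -EFinN opprK.
- apply: continuous_subspaceT => x; apply: differentiable_continuous.
  exact/derivable1_diffP.
- rewrite -[X in _ --> X](mulr0 (- c^-1)); apply: cvgM; first exact: cvg_cst.
  apply: (@cvg_comp _ _ _ (fun t => c * t) (fun z => expR (- z)) _
    (pinfty_nbhs R)); [exact: gt0_cvgMry|exact: cvgr_expR].
- apply: cvg_at_right_filter.
  by apply: (@differentiable_continuous _ _ _ _ F); exact/derivable1_diffP.
- by move=> x _; rewrite derive1E derive_val.
Qed.

(** * The Gamma function: integrability, recurrence, and growth of the quotient *)

Section Gamma.
Context {R : realType}.
Local Notation mu := (@lebesgue_measure R).

Let g (s t : R) : R := t `^ (s - 1) * expR (- t).

Let measurable_g (s : R) : measurable_fun setT (g s).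
Proof.
apply: measurable_funM; first exact: measurable_powR.
exact: measurableT_comp.
Qed.

Let integrable_expR_half :
  mu.-integrable `]0, +oo[ (fun t => (expR (- (t / 2)))%:E).
Proof.
apply: (@integrableS _ _ R mu `[0, +oo[%classic) => //.
  by apply: subset_itv; rewrite bnd_simp.
apply/integrableP; split.
  apply/measurable_EFinP/measurable_funTS; apply: measurableT_comp => //.
  by apply: measurableT_comp => //; exact: measurable_funM.
under eq_integral do rewrite gee0_abs ?lee_fin ?expR_ge0// mulrC.
by rewrite integral_expR_cy// ltry.
Qed.

(** Half of the decay of [expR (- t)] absorbs the power; the other half remains as an integrable
    majorant. *)
Let g_le (s t : R) : 1 <= s -> 0 < t ->
  g s t <= (2 * (s - 1)) `^ (s - 1) * expR (- (t / 2)).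
Proof.
move=> s1 t0; rewrite /g.
rewrite (le_trans (ler_wpM2r (expR_ge0 _) (powR_le_expR _ t0)))//.
  by rewrite subr_ge0.
by rewrite -mulrA -expRD ler_wpM2l ?powR_ge0// ler_expR; lra.
Qed.

Lemma integrable_Gamma (s : R) : 1 <= s ->
  mu.-integrable `]0, +oo[ (fun t => (t `^ (s - 1) * expR (- t))%:E).
Proof.
move=> s1.
apply: (@le_integrable _ _ R mu `]0, +oo[%classic _ _
  (fun t : R =>
    (((2 * (s - 1)) `^ (s - 1))%:E * (expR (- (t / 2)))%:E)%E)) => //.
- by apply/measurable_EFinP/measurable_funTS; exact: measurable_g.
- move=> t /=; rewrite in_itv/= andbT => t0.
  rewrite lee_fin !ger0_norm ?mulr_ge0 ?expR_ge0 ?powR_ge0//.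
  exact: g_le.
- exact: integrableZl.
Qed.

Lemma GammaE (s : R) :
  Gamma s = \int[mu]_(t in `]0, +oo[) (t `^ (s - 1) * expR (- t)).
Proof. by []. Qed.

Lemma Gamma1 : Gamma (1 : R) = 1.
Proof.
rewrite /Gamma.
rewrite integral_itv_obnd_cbnd; last first.
  by apply/measurable_EFinP/measurable_funTS; exact: (measurable_g 1).
under eq_integral do rewrite subrr powRr0 mul1r -[X in expR (- X)]mul1r.
by rewrite integral_expR_cy// invr1.
Qed.

Lemma Gamma_gt0 (s : R) : 1 <= s -> 0 < Gamma s.
Proof.
move=> s1; rewrite /Gamma fine_gt0//.
(* Since [fine] sends infinity to 0, positivity of [Gamma s] requires a finite integral. The lower
   bound then comes from [[1, 2]], where [t ^ (s - 1) >= 1]. *)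
have : (\int[mu]_(t in `]0%R, +oo[) (t `^ (s - 1) * expR (- t))%:E)%E
    \is a fin_num.
  by apply: integrable_fin_num => //; exact: integrable_Gamma.
move/fin_numPlt/andP => [_ ->].
rewrite andbT.
apply: (@lt_le_trans _ _ (\int[mu]_(t in `[1%R, 2%R]) (expR (- 2))%:E)%E).
  rewrite integral_cst//= lebesgue_measure_itv/= lte_fin ltrDl ltr01.
  rewrite -EFinB -EFinM lte_fin.
  by rewrite mulr_gt0 ?expR_gt0// addrK.
apply: (@le_trans _ _ (\int[mu]_(t in `[1%R, 2%R]) (g s t)%:E)%E).
  apply: ge0_le_integral => //.
  - by apply/measurable_EFinP/measurable_funTS; exact: measurable_g.
  - move=> x /=; rewrite in_itv/= => /andP[x1 x2].
    rewrite lee_fin /g -[leLHS]mul1r ler_pM ?expR_ge0//.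
      by rewrite -[leLHS](powRr0 x) ler_powR// subr_ge0.
    by rewrite ler_expR lerN2.
apply: ge0_subset_integral => //.
- by apply/measurable_EFinP/measurable_funTS; exact: measurable_g.
- by move=> x _; rewrite lee_fin mulr_ge0 ?powR_ge0 ?expR_ge0.
- by apply: subset_itv; rewrite bnd_simp.
Qed.

Let cvg_powR0 (r : R) : 0 < r -> x `^ r @[x --> 0^'+] --> (0 : R) `^ r.
Proof. by move=> r0; rewrite powR0 ?gt_eqF//; exact: powR_cvg0. Qed.

Let cvg_g0 (s : R) : 1 < s -> g s x @[x --> 0^'+] --> g s 0.
Proof.
move=> s1; apply: cvgM; first by apply: cvg_powR0; rewrite subr_gt0.
apply: cvg_at_right_filter.
by apply: (@continuous_comp R R R -%R expR 0);
  [exact: opp_continuous|exact: continuous_expR].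
Qed.

Let is_derive_g (s t : R) : 0 < t ->
  is_derive t 1 (g s) ((s - 1) * g (s - 1) t - g s t).
Proof.
move=> t0; have dp := is_derive1_powR (s - 1) t0.
apply: is_derive_eq; rewrite /GRing.scale/= /g.
ring.
Qed.

Lemma GammaS (s : R) : 1 < s -> Gamma (s + 1) = s * Gamma s.
Proof.
move=> s1; have s0 : 0 < s by lra.
(* Adding [K / 2 * exp (- t / 2)] makes the derivative of [- t^s exp (- t)]
   nonnegative, as the fundamental theorem on [0, +oo[ requires. *)
pose K := 2 * (s * (2 * (s - 1)) `^ (s - 1)).
pose F (t : R) := - g (s + 1) t - K * expR (- (t / 2)).
pose f (t : R) := g (s + 1) t - s * g s t + K / 2 * expR (- (t / 2)).
have dF (t : R) : 0 < t -> is_derive t 1 F (f t).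
  move=> t0; have dg := is_derive_g (s + 1) t0.
  apply: is_derive_eq; rewrite /GRing.scale/= /f !addrK.
  by field.
have K0 : 0 <= K by rewrite !mulr_ge0 ?powR_ge0 ?(ltW s0).
have f0 (t : R) : 0 <= t -> 0 <= f t.
  rewrite le_eqVlt => /predU1P[<-|t0].
    (* At 0 both powers vanish, their exponents [s] and [s - 1] being nonzero. *)
    rewrite /f /g !powR0 ?mul0r ?mulr0 ?subr0 ?add0r; [|lra|lra].
    by rewrite mulr_ge0 ?expR_ge0// divr_ge0.
  have gs := g_le (ltW s1) t0.
  (* [K / 2] is [s] times the constant in [g_le], so the correction dominates the only negative term
     of [f]. *)
  have : s * g s t <= K / 2 * expR (- (t / 2)).
    by rewrite /K (mulrC 2) mulfK// -mulrA ler_pM2l.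
  have : 0 <= g (s + 1) t by rewrite mulr_ge0 ?powR_ge0 ?expR_ge0.
  by rewrite /f; lra.
have ce : continuous (fun t : R => expR (- (t / 2))).
  by move=> x; apply: differentiable_continuous; exact/derivable1_diffP.
have cg u (t : R) : 0 < t -> {for t, continuous (g u)}.
  move=> t0; apply: differentiable_continuous; apply/derivable1_diffP.
  by have [] := is_derive_g u t0.
have int0 : \int[mu]_(t in `[0, +oo[) f t = 0 - F 0.
  apply: Rintegral_ge0_continuous_FTC2y => //.
  - apply/continuous_within_itvcyP; split.
      move=> t; rewrite in_itv/= andbT => t0.
      apply: cvgD; last by apply: cvgM; [exact: cvg_cst|exact: ce].
      apply: cvgB; first exact: cg.
      by apply: cvgM; [exact: cvg_cst|exact: cg].
    apply: cvgD; last first.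
      by apply: cvgM; [exact: cvg_cst|apply: cvg_at_right_filter; exact: ce].
    apply: cvgB; first by apply: cvg_g0; lra.
    by apply: cvgM; [exact: cvg_cst|exact: cvg_g0].
  - have ceh : expR (- (t / 2)) @[t --> +oo%R] --> (0 : R).
      apply: (@cvg_comp _ _ _ (fun t => t / 2) (fun z => expR (- z)) _
        (pinfty_nbhs R)); [exact: gt0_cvgMly|exact: cvgr_expR].
    have cKe k : k * expR (- (t / 2)) @[t --> +oo%R] --> (0 : R).
      rewrite -[X in _ --> X](mulr0 k).
      by apply: cvgM => //; exact: cvg_cst.
    rewrite -[X in _ --> X](subr0 0); apply: cvgB; last exact: cKe.
    rewrite -oppr0; apply: cvgN.
    apply: (@squeeze_cvgr _ _ _ _ (fun=> 0)
      (fun t => (2 * (s + 1 - 1)) `^ (s + 1 - 1) * expR (- (t / 2)))).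
    + near=> t; rewrite mulr_ge0 ?powR_ge0 ?expR_ge0//=.
      by apply: g_le => //; lra.
    + exact: cvg_cst.
    + exact: cKe.
  - by move=> t t0; have [] := dF t t0.
  - apply: cvgB; first by apply: cvgN; apply: cvg_g0; lra.
    by apply: cvgM; [exact: cvg_cst|apply: cvg_at_right_filter; exact: ce].
  - move=> t; rewrite in_itv/= andbT => t0; rewrite derive1E.
    by have [_ ->] := dF t t0.
have inte := integrable_expR_half.
have intg := @integrable_Gamma s (ltW s1).
have intgS : mu.-integrable `]0, +oo[ (EFin \o g (s + 1)).
  by apply: integrable_Gamma; lra.
have intsg : mu.-integrable `]0, +oo[ (EFin \o (fun t => s * g s t)).
  exact: (@integrableZl _ _ R mu `]0, +oo[%classic _ s (EFin \o g s)).
have intKe : mu.-integrable `]0, +oo[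
    (EFin \o (fun t => K / 2 * expR (- (t / 2)))).
  exact: (@integrableZl _ _ R mu `]0, +oo[%classic _ (K / 2)
    (EFin \o (fun t => expR (- (t / 2))))).
have intgB : mu.-integrable `]0, +oo[
    (EFin \o (fun t => g (s + 1) t - s * g s t)).
  exact: (@integrableB _ _ R mu `]0, +oo[%classic _ (EFin \o g (s + 1))
    (EFin \o (fun t => s * g s t))).
have intf : mu.-integrable `]0, +oo[ (EFin \o f).
  exact: (@integrableD _ _ R mu `]0, +oo[%classic _
    (EFin \o (fun t => g (s + 1) t - s * g s t))
    (EFin \o (fun t => K / 2 * expR (- (t / 2))))).
move: int0; rewrite -Rintegral_itv_obnd_cbnd//.
rewrite RintegralD// RintegralB// !RintegralZl//.
(* The correction contributes [K / 2 * 2 = K] to the integral, and [- F 0] is also [K]; what remains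
   is the recurrence. *)
have -> : \int[mu]_(t in `]0, +oo[) expR (- (t / 2)) = 2.
  rewrite Rintegral_itv_obnd_cbnd//.
  rewrite /Rintegral; under eq_integral do rewrite mulrC.
  by rewrite integral_expR_cy//= invrK.
rewrite !GammaE -!/(g _ _) /F /g powR0; last lra.
rewrite mul0r mul0r oppr0 expR0.
by set a := Rintegral _ _ _; set b := Rintegral _ _ _; lra.
Unshelve. all: by end_near. Qed.

(* Chebyshev's association inequality for [t ^ (a - 1)] and [t ^ a] under the
   law [exp (- t) dt]; at [t0] the first function equals its mean. *)
Lemma Gamma_chebyshev (a : R) : 1 < a ->
  Gamma (a + 1) * Gamma a <= Gamma (2 * a).
Proof.
move=> a1; have c0 := Gamma_gt0 (ltW a1).
set c := Gamma a in c0 *.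
pose t0 := c `^ (a - 1)^-1.
have t00 : 0 < t0 by rewrite powR_gt0.
have t0c : t0 `^ (a - 1) = c.
  by rewrite -powRrM mulVf ?powRr1 ?(ltW c0)// subr_eq0 gt_eqF.
pose d := t0 `^ a.
have intg s : 1 <= s -> mu.-integrable `]0, +oo[ (EFin \o g s).
  exact: integrable_Gamma.
have intZ k s : 1 <= s ->
    mu.-integrable `]0, +oo[ (EFin \o (fun t => k * g s t)).
  move=> s1.
  apply: (@integrableZl _ _ R mu `]0, +oo[%classic _ k (EFin \o g s)) => //.
  exact: intg.
have i1 := intZ c (a + 1) ltac:(lra).
have i2 := intZ d a ltac:(lra).
have i3 := intZ (c * d) 1 ltac:(lra).
have i4 := intg (2 * a) ltac:(lra).
have i12 : mu.-integrable `]0, +oo[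
    (EFin \o (fun t => c * g (a + 1) t + d * g a t)).
  exact: (@integrableD _ _ R mu `]0, +oo[%classic _
    (EFin \o (fun t => c * g (a + 1) t)) (EFin \o (fun t => d * g a t))).
have i43 : mu.-integrable `]0, +oo[
    (EFin \o (fun t => g (2 * a) t + c * d * g 1 t)).
  exact: (@integrableD _ _ R mu `]0, +oo[%classic _
    (EFin \o g (2 * a)) (EFin \o (fun t => c * d * g 1 t))).
have : \int[mu]_(t in `]0, +oo[) (c * g (a + 1) t + d * g a t) <=
       \int[mu]_(t in `]0, +oo[) (g (2 * a) t + c * d * g 1 t).
  apply: le_Rintegral => // t /=; rewrite in_itv/= andbT => tp.
  rewrite -subr_ge0.
  have -> : g (2 * a) t + c * d * g 1 t - (c * g (a + 1) t + d * g a t) =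
            (t `^ (a - 1) - t0 `^ (a - 1)) * (t `^ a - t0 `^ a) * expR (- t).
    rewrite /g subrr powRr0 t0c -/d addrK.
    have -> : 2 * a - 1 = (a - 1) + a by ring.
    rewrite powRD; last by rewrite (gt_eqF tp) implybT.
    by ring.
  rewrite mulr_ge0 ?expR_ge0//.
  have [tt|tt] := leP t0 t.
    by rewrite mulr_ge0// subr_ge0; apply: ge0_ler_powR;
      rewrite ?nnegrE ?(ltW tp) ?(ltW t00)//; lra.
  by rewrite mulr_le0// subr_le0; apply: ge0_ler_powR;
    rewrite ?nnegrE ?(ltW tp) ?(ltW t00) ?(ltW tt)//; lra.
rewrite !RintegralD// ?RintegralZl//; [|by apply: intg; lra..].
(* The integrated inequality is [c * Gamma (a + 1) + d * c <= Gamma (2 * a) + c * d]; the choice of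
   [t0] is what makes the terms in [d] cancel. *)
rewrite -![Rintegral _ _ _]/(Gamma _) Gamma1 -/c.
by lra.
Qed.

(** Induction on an integer [n] with [a <= n + 2]. For [a <= 2] the left side is at most 1;
    otherwise [a] descends to [b = a - 1], and the recurrence multiplies the quotient by
    [2 * (2 * b + 1) / (b + 1) >= 2]. *)
Lemma Gamma_quotient_ge (a : R) : 1 < a ->
  2 `^ (a - 2) <= Gamma (2 * a) / (Gamma (a + 1) * Gamma a).
Proof.
move=> a1; have [n] : exists n : nat, a <= n%:R + 2.
  by exists (Num.truncn a).+1; rewrite (le_trans (ltW (truncnS_gt a)))// lerDl.
elim: n a a1 => [|n IH] a a1 an.
  apply: (@le_trans _ _ 1).
    by rewrite -[leRHS](powRr0 2) ler_powR ?ler1n//; lra.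
  rewrite ler_pdivlMr ?mul1r ?Gamma_chebyshev//.
  by rewrite mulr_gt0 ?Gamma_gt0//; lra.
(* The descent to [a - 1] must keep the argument above 1, so [a <= 2] is handled by the hypothesis
   at [a] itself. *)
have [a2|a2] := leP a 2.
  by apply: IH => //; rewrite (le_trans a2)// lerDr.
have b1 : 1 < a - 1 by lra.
have := IH _ b1; rewrite -natr1 in an => /(_ ltac:(lra)).
set b := a - 1 in b1 * => h; have -> : a = b + 1 by rewrite /b subrK.
have -> : b + 1 - 2 = (b - 2) + 1 by ring.
rewrite powRD ?pnatr_eq0 ?implybT// powRr1//.
have -> : 2 * (b + 1) = 2 * b + 1 + 1 by ring.
rewrite (@GammaS (2 * b + 1)); last lra.
rewrite (@GammaS (2 * b)); last lra.
rewrite (@GammaS (b + 1)); last lra.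
rewrite (@GammaS b)// in h *.
have Gb : 0 < Gamma b by apply: Gamma_gt0; lra.
have G2b : 0 < Gamma (2 * b) by apply: Gamma_gt0; lra.
have -> : (2 * b + 1) * (2 * b * Gamma (2 * b)) /
    ((b + 1) * (b * Gamma b) * (b * Gamma b)) =
  Gamma (2 * b) / (b * Gamma b * Gamma b) * (2 * (2 * b + 1) / (b + 1)).
  by field; rewrite !gt_eqF//=; lra.
apply: ler_pM => //; rewrite ?powR_ge0//.
by rewrite ler_pdivlMr; lra.
Qed.

End Gamma.

(** * Lower bound for the constant *)

Lemma A_const_ge (R : realType) (p : R) : 1 < p -> p < 2 ->
  2 `^ (2 / conj_exp p) <= A_const p.
Proof.
move=> p1 p2; rewrite /A_const /conj_exp.
pose a := p / (2 - p).
have d0 : 2 - p != 0 by lra.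
have e0 : p - 1 != 0 by lra.
have p0 : p != 0 by lra.
have a1 : 1 < a by rewrite /a ltr_pdivlMr; lra.
have am : a - 1 != 0 by lra.
have a0 : a != 0 by lra.
have -> : 2 / (p / (p - 1)) = (a - 1) / a.
  by rewrite /a; field; rewrite ?p0 ?d0 ?e0.
have -> : p / (p - 1) / 2 = a / (a - 1).
  by rewrite /a; field; rewrite ?p0 ?d0 ?e0; lra.
have -> : 2 * p / (2 - p) = 2 * a by rewrite /a; field.
have -> : 2 / (2 - p) = a + 1 by rewrite /a; field.
rewrite -/a.
have -> : 2 / p - 1 = a^-1 by rewrite /a; field; rewrite ?p0 ?d0.
have -> : 2 / p = (a + 1) * a^-1 by rewrite /a; field; rewrite ?p0 ?d0 ?e0.
have ai : 0 <= a^-1 by rewrite invr_ge0; lra.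
have C2 := Gamma_quotient_ge a1.
set C := Gamma _ / _ in C2 *.
have C0 : 0 <= C by apply: le_trans C2; exact: powR_ge0.
clearbody C.
rewrite !powRrM -powRM ?powR_ge0//.
apply: ge0_ler_powR; rewrite ?nnegrE ?mulr_ge0 ?powR_ge0//.
have -> : a - 1 = 1 + (a - 2) by ring.
rewrite powRD ?pnatr_eq0 ?implybT// powRr1//.
apply: ler_pM; rewrite ?powR_ge0//.
(* Here [1 + (a - 2)] is [a - 1]. The first factor is at least [expR ((a + 1) / a) >= 1 + (a + 1) /
   a = 2 + a^-1]. *)
have x0 : 0 < a / (1 + (a - 2)) by rewrite divr_gt0; lra.
apply: le_trans (expR_le_powR x0 _); last lra.
apply: le_trans (expR_ge1Dx _).
rewrite invf_div.
have -> : 1 - (1 + (a - 2)) / a = a^-1 by field.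
by rewrite mulrDl mulfV// mul1r; lra.
Qed.

(** * Convolution with the exponential kernel *)

Section exponential_kernel.
Context {R : realType}.
Local Notation mu := (@lebesgue_measure R).

Lemma integral_expR_dist (c x : R) : 0 < c ->
  (\int[mu]_y (expR (- (c * `|x - y|)))%:E = (2 / c)%:E)%E.
Proof.
move=> c0; pose G (y : R) := expR (- (c * `|y|)).
have cG : continuous G.
  move=> y; apply: continuous_comp; last exact: continuous_expR.
  apply: cvgN; apply: cvgM; first exact: cvg_cst.
  exact: norm_continuous.
pose F (y : R) := y - x.
have F1 : F^`()%classic = cst 1.
  by apply/funext => y; rewrite derive1E derive_val subr0.
(* The centred kernel is even, so its integral is twice the half-line one; the substitution [F] then
   moves the centre to [x]. *)
have <- : (\int[mu]_y (G y)%:E = (2 / c)%:E)%E.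
  rewrite ge0_symfun_integralT//; last 2 first.
  - by move=> y; rewrite expR_ge0.
  - by move=> y; rewrite /G /= normrN.
  rewrite -set_itvcy EFinM -(integral_expR_cy c0); congr (_ * _)%E.
  apply: eq_integral => y; rewrite inE/= in_itv/= andbT => y0.
  by rewrite /G ger0_norm.
rewrite (@increasing_ge0_integration_by_substitutionT R F G)//; last 7 first.
- by move=> y z; rewrite /F ltrD2r.
- by rewrite F1; exact: cst_continuous.
- by rewrite F1; exact: is_cvg_cst.
- by rewrite F1; exact: is_cvg_cst.
- apply/cvgrNyPle => A; near=> y; rewrite /F lerBlDr.
  by near: y; apply: nbhs_ninfty_le; exact: num_real.
- apply/cvgryPge => A; near=> y; rewrite /F lerBrDr.
  by near: y; apply: nbhs_pinfty_ge; exact: num_real.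
- by move=> y; rewrite expR_ge0.
by apply: eq_integral => y _; rewrite F1 /= /G /F !fctE mulr1 distrC.
Unshelve. all: by end_near. Qed.

Context (f : R -> R) (mf : measurable_fun setT f).

Let mdist (c : R) :
  measurable_fun setT (fun z : R * R => expR (- (c * `|z.1 - z.2|))).
Proof.
apply: measurableT_comp => //; apply: measurableT_comp => //.
apply: measurable_funM => //; apply: measurableT_comp => //.
by apply: measurable_funB.
Qed.

Lemma measurable_convol_expdens : measurable_fun setT (convol (@expdens R) f).
Proof.
pose h (z : R * R) := (expdens (z.1 - z.2) * f z.2)%:E.
have mh : measurable_fun setT h.
  apply/measurable_EFinP; apply: measurable_funM; last exact: measurableT_comp.
  have := mdist 1; apply: eq_measurable_fun => z _.
  by rewrite /expdens mul1r.
(* Tonelli measurability concerns nonnegative integrands, hence the split into positive and negative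
   parts. *)
rewrite (_ : convol _ _ = (fun x =>
  \int[mu]_y h^\+%E (x, y) - \int[mu]_y h^\-%E (x, y))%E).
  apply: emeasurable_funB.
    apply: (@measurable_fun_fubini_tonelli_F _ _ _ _ R mu h^\+%E) => //.
    exact: measurable_funepos.
  apply: (@measurable_fun_fubini_tonelli_F _ _ _ _ R mu h^\-%E) => //.
  exact: measurable_funeneg.
apply/funext => x; rewrite /convol integralE; congr (_ - _)%E;
  by apply: eq_integral => y _; rewrite ?funeposE ?funenegE.
Qed.

Let mdist1 (c x : R) :
  measurable_fun setT (fun y : R => expR (- (c * `|x - y|))).
Proof.
apply: measurableT_comp => //; apply: measurableT_comp => //.
apply: measurable_funM => //; apply: measurableT_comp => //.
by apply: measurable_funB.
Qed.

Local Open Scope ereal_scope.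

Lemma convol_expdens_hoelder (p q x : R) : (0 < p)%R -> (0 < q)%R ->
  (p^-1 + q^-1 = 1)%R ->
  `|convol (@expdens R) f x| <=
  (\int[mu]_y (expR (- (p / 2 * `|x - y|)) * `|f y| `^ p)%:E) `^ p^-1 *
  (4 / q)%:E `^ q^-1.
Proof.
move=> p0 q0 pq.
(* [v] is the square root of the kernel, so [u * v] is the convolution integrand, and the integral
   of [v ^ q] is [2 / (q / 2) = 4 / q]. *)
pose v (y : R) : R := expR (- (2^-1 * `|x - y|))%R.
pose u (y : R) := (v y * f y)%R.
have mv : measurable_fun setT v by exact: mdist1.
have mu' : measurable_fun setT u by exact: measurable_funM.
have vv y : (v y * v y = expR (- `|x - y|))%R.
  by rewrite /v -expRD; congr expR; field.
have := hoelder mu mu' mv p0 q0 pq.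
rewrite Lnorm1.
have -> : Lnorm mu p%:E (EFin \o u) =
    (\int[mu]_y (expR (- (p / 2 * `|x - y|)) * `|f y| `^ p)%:E) `^ p^-1.
  rewrite unlock; congr (_ `^ _); apply: eq_integral => y _.
  rewrite /= /u normrM powRM// ger0_norm ?expR_ge0// -expRM.
  by congr (expR _ * _)%:E; field.
have -> : Lnorm mu q%:E (EFin \o v) = (4 / q)%:E `^ q^-1.
  rewrite unlock; congr (_ `^ _).
  have -> : (4 / q = 2 / (q / 2) :> R)%R by field; rewrite gt_eqF.
  rewrite -(integral_expR_dist x); last by rewrite divr_gt0.
  apply: eq_integral => y _; rewrite /= ger0_norm ?expR_ge0// -expRM.
  by congr (expR _)%:E; field.
apply: le_trans; rewrite /convol.
apply: le_trans (le_abse_integral _ _ _) _ => //.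
  apply/measurable_EFinP; apply: measurable_funM => //.
  have := mdist1 1 x; apply: eq_measurable_fun => y _.
  by rewrite /expdens mul1r.
rewrite le_eqVlt; apply/orP; left; apply/eqP/eq_integral => y _ /=.
by rewrite /u mulrAC vv.
Qed.

(** The constant [16 / (p * q)] is the Hoelder factor [4 / q] times [4 / p], the mass of the kernel
    in [H]. *)
Lemma Lnorm_convol_expdens (p q : R) : (0 < p)%R -> (p < q)%R ->
  (p^-1 + q^-1 = 1)%R -> \int[mu]_y (`|f y| `^ p)%:E < +oo ->
  Lnorm mu q%:E (convol (@expdens R) f) <=
  ((16 / (p * q)) `^ q^-1)%:E * Lnorm mu p%:E (EFin \o f).
Proof.
move=> p0 pq pq1; set M := \int[mu]_y _ => Moo.
have q0 : (0 < q)%R by apply: lt_trans pq.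
have M0 : 0 <= M by apply: integral_ge0 => y _; rewrite lee_fin powR_ge0.
pose m := fine M.
have ME : M = m%:E by rewrite fineK// ge0_fin_numE.
have m0 : (0 <= m)%R by exact: fine_ge0.
have mfp : measurable_fun setT (fun y => `|f y| `^ p)%R.
  apply: (@measurableT_comp _ _ _ _ _ _ (@powR R ^~ p)) => //.
  exact: measurableT_comp.
pose H (x : R) := \int[mu]_y (expR (- (p / 2 * `|x - y|)) * `|f y| `^ p)%:E.
pose k (z : R * R) := (expR (- (p / 2 * `|z.1 - z.2|)) * `|f z.2| `^ p)%:E.
have k0 z : 0 <= k z by rewrite lee_fin mulr_ge0 ?expR_ge0 ?powR_ge0.
have mk : measurable_fun setT k.
  apply/measurable_EFinP; apply: measurable_funM; first exact: mdist.
  exact: (measurableT_comp mfp).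
have mH : measurable_fun setT H.
  exact: (@measurable_fun_fubini_tonelli_F _ _ _ _ R mu k).
have H0 x : 0 <= H x by apply: integral_ge0 => y _; exact: (k0 (x, y)).
have HM x : H x <= M.
  apply: ge0_le_integral => //.
  - apply/measurable_EFinP; apply: measurable_funM => //; exact: mdist1.
  - exact/measurable_EFinP.
  - move=> y _; rewrite lee_fin ler_piMl ?powR_ge0//.
    by rewrite expR_le1 oppr_le0 mulr_ge0 ?divr_ge0 ?(ltW p0).
have intH : \int[mu]_x H x = (4 / p)%:E * M.
  transitivity (\int[mu]_y \int[mu]_x k (x, y));
    first exact: (@fubini_tonelli _ _ _ _ R mu mu k mk k0).
  rewrite -ge0_integralZl//; last 2 first.
  - exact/measurable_EFinP.
  - by rewrite lee_fin divr_ge0// ltW.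
  apply: eq_integral => y _; rewrite /k/=.
  under eq_integral do rewrite EFinM distrC.
  rewrite ge0_integralZr//; last first.
    by apply/measurable_EFinP; exact: mdist1.
  rewrite integral_expR_dist ?divr_gt0//; congr (_%:E * _).
  by field; rewrite gt_eqF.
have qp : (0 < q * p^-1 - 1)%R by rewrite subr_gt0 ltr_pdivlMr// mul1r.
(* The [q]-th power of the Hoelder bound contains [H x ^ (q / p)]. One factor [H x] is kept for
   Tonelli, and the remaining power, positive as [p < q], is bounded through [H x <= M]. *)
have pw x : `|convol (@expdens R) f x| `^ q <=
    (4 / q)%:E * M `^ (q * p^-1 - 1) * H x.
  have := convol_expdens_hoelder x p0 q0 pq1; rewrite -/(H x).
  move=> /(gt0_ler_poweR (ltW q0)) => /(_ _ _)/le_trans; apply.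
  - by rewrite in_itv/= abse_ge0 ?leey.
  - by rewrite in_itv/= leey andbT mule_ge0 ?poweR_ge0// lee_fin powR_ge0.
  rewrite poweRM ?poweR_ge0// -!poweRrM mulVf ?gt_eqF// poweRe1; last first.
    by rewrite lee_fin divr_ge0// ltW.
  rewrite muleC -muleA; apply: lee_wpmul2l.
    by rewrite lee_fin divr_ge0// ltW.
  move: (H0 x) (HM x); case: (H x) => [h| |//]; last first.
    by move=> _; rewrite leNgt Moo.
  rewrite ME => h0 hm.
  rewrite !poweR_EFin -EFinM lee_fin (mulrC p^-1%R) [X in (_ <= X)%R]mulrC.
  rewrite !lee_fin in h0 hm.
  rewrite -[X in (X <= _)%R](@mulr_powRB1 _ _ (q * p^-1)%R)//; last first.
    by rewrite mulr_gt0 ?invr_gt0.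
  by rewrite ler_wpM2l//; apply: ge0_ler_powR; rewrite ?nnegrE ?(ltW qp).
rewrite ![in leLHS]unlock ![in leRHS]unlock.
have -> : \int[mu]_x `|(EFin \o f) x| `^ p = M by [].
rewrite -(poweR_EFin _ q^-1%R).
(* Both sides become [q^-1]-th powers, which reduces the claim to their bases. *)
have -> : M `^ p^-1 = (M `^ (q * p^-1)) `^ q^-1.
  by rewrite -poweRrM mulrAC mulfV ?mul1r// gt_eqF.
rewrite -poweRM ?poweR_ge0//; last by rewrite lee_fin divr_ge0// mulr_ge0 ?ltW.
have c0 : 0 <= (4 / q)%:E * M `^ (q * p^-1 - 1).
  by rewrite mule_ge0 ?poweR_ge0// lee_fin divr_ge0// ltW.
have mconv := measurable_convol_expdens.
apply: gt0_ler_poweR; rewrite ?invr_ge0 ?(ltW q0)//.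
- by rewrite in_itv/= leey andbT integral_ge0// => x _; exact: poweR_ge0.
- rewrite in_itv/= leey andbT mule_ge0 ?poweR_ge0// lee_fin.
  by rewrite divr_ge0// mulr_ge0 ?ltW.
apply: (@le_trans _ _ (\int[mu]_x ((4 / q)%:E * M `^ (q * p^-1 - 1) * H x))).
  apply: ge0_le_integral => //.
  - by move=> x _; exact: poweR_ge0.
  - apply: (@measurableT_comp _ _ _ _ _ _ (@poweR R ^~ q)) => //.
      exact: measurable_poweR.
    exact: measurableT_comp.
  - exact: measurable_funeM.
rewrite ge0_integralZl// intH ME !poweR_EFin -!EFinM lee_fin.
rewrite -(@mulr_powRB1 _ m (q * p^-1)%R) ?mulr_gt0 ?invr_gt0//.
rewrite le_eqVlt; apply/orP; left; apply/eqP.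
by field; rewrite !gt_eqF.
Qed.

End exponential_kernel.

(** * Comparison of the two constants *)

Theorem theorem3 (R : realType) (p : R) (hp1 : 1 < p) (hp2 : p < 2)
  (f : R -> R) (hf : f \in Lfun (@lebesgue_measure R) p%:E) :
  (Lnorm (@lebesgue_measure R) (conj_exp p)%:E (convol (@expdens R) f)
    <= (A_const p)%:E * Lnorm (@lebesgue_measure R) p%:E (EFin \o f))%E.
Proof.
have mf : measurable_fun setT f by have := set_mem (sub_Lfun_mfun hf).
have p0 : 0 < p by lra.
have fin : (\int[@lebesgue_measure R]_y (`|f y| `^ p)%:E < +oo)%E.
  have := set_mem (sub_Lfun_finLfun hf); rewrite /= /finite_norm unlock.
  by apply: lty_poweRy; rewrite invr_neq0// gt_eqF.
have d0 : p - 1 != 0 by lra.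
have q0 : 0 < conj_exp p by rewrite /conj_exp divr_gt0//; lra.
have pq : p < conj_exp p by rewrite /conj_exp ltr_pdivlMr; nra.
have pq1 : p^-1 + (conj_exp p)^-1 = 1.
  by rewrite /conj_exp; field; rewrite ?d0 gt_eqF.
apply: le_trans (Lnorm_convol_expdens mf p0 pq pq1 fin) _.
apply: lee_wpmul2r; first exact: Lnorm_ge0.
rewrite lee_fin; apply: le_trans (A_const_ge hp1 hp2).
(* As [2 ^ (2 / q) = 4 ^ (1 / q)], it remains to see that [p * q >= 4]; indeed
   [p * q - 4 = (p - 2) ^ 2 / (p - 1)]. *)
rewrite powRrM (_ : 2 `^ 2 = 4); last by rewrite (powR_mulrn 2)// expr2; ring.
have pq0 : 0 < p * conj_exp p by rewrite mulr_gt0.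
apply: ge0_ler_powR; rewrite ?nnegrE ?invr_ge0 ?(ltW q0)//.
  by rewrite divr_ge0 ?(ltW pq0).
rewrite ler_pdivrMr// /conj_exp.
have -> : 4 * (p * (p / (p - 1))) = 16 + 4 * (p - 2) ^+ 2 / (p - 1) by field.
rewrite lerDl divr_ge0//; last lra.
by rewrite mulr_ge0 ?sqr_ge0.
Qed.
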